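(* Let $\Gamma$ be a group and $\epsilon>\eta(\Gamma)$. Then $$\sup_\Lambda\frac{\beta^{(2)}_1(\Lambda)}{\mathrm{rk}(\Lambda)^{\epsilon}}<\infty,$$ where the supremum runs over all finitely generated subgroups $\Lambda$ of $\Gamma$.
   Context: $\beta^{(2)}_1(\Lambda)$ is the first $L^2$-Betti number of $\Lambda$ and $\mathrm{rk}(\Lambda)$ the minimal number of generators of $\Lambda$. For finite symmetric $S\subseteq\Gamma$: $\mathrm{Cay}(\Gamma,S)$ has vertex set $\Gamma$ and an edge between $g$ and $gs$ for each $s\in S$; $\partial_SF$ is the set of edges from a finite $F$ to its complement; $h(\Gamma,S)=\inf_F|\partial_SF|/|F|$ over non-empty finite $F$; $e(\Gamma,S)=1-h(\Gamma,S)/|S|$. $\eta(\Gamma)=-\liminf_S\frac{\ln e(\Gamma,S)}{\ln|S|}$, the liminf over the directed set of finite symmetric subsets ordered by inclusion ($\liminf_Sf(S)=\sup_S\inf_{S'\supseteq S}f(S')$), with $\eta(\Gamma)=-\infty$ if $\Gamma$ is finite. *)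

(* Defs.v *)
From HB Require Import structures.
From mathcomp Require Import all_boot all_order all_algebra.
From mathcomp Require Import all_classical all_reals all_analysis.
From mathcomp Require Import Rstruct.
From Stdlib Require Import ClassicalEpsilon Rdefinitions.

Set Implicit Arguments.
Unset Strict Implicit.
Unset Printing Implicit Defensive.

Import Order.TTheory GRing.Theory Num.Theory.
Local Open Scope ring_scope.
Local Open Scope classical_set_scope.

Record AbsGroup := {
  carrier :> eqType;
  gmul : carrier -> carrier -> carrier;
  ginv : carrier -> carrier;
  gone : carrier;
  gmulA : forall x y z, gmul x (gmul y z) = gmul (gmul x y) z;
  gmul1 : forall x, gmul x gone = x;
  gone_mul : forall x, gmul gone x = x;
  gmulV : forall x, gmul x (ginv x) = gone;
  gVmul : forall x, gmul (ginv x) x = gone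
}.

Section GroupDefs.
Variable G : AbsGroup.

Local Notation "x *g y" := (gmul x y) (at level 40, left associativity).

Definition is_subgroup (H : G -> Prop) : Prop :=
  [/\ H (gone G), (forall x y, H x -> H y -> H (x *g y)) & (forall x, H x -> H (ginv x))].

Definition generates (H : G -> Prop) (S : seq G) : Prop :=
  is_subgroup H /\ (forall s, s \in S -> H s) /\
  (forall K : G -> Prop, is_subgroup K -> (forall s, s \in S -> K s) -> forall x, H x -> K x).

Definition fin_gen (H : G -> Prop) : Prop := exists S : seq G, generates H S.

Definition rk (H : G -> Prop) : R :=
  inf [set (size S)%:R | S in [set S : seq G | generates H S]].

(* Functions G -> R supported on H model elements of R^H; the left regular
   action is (g . xi)(x) = xi (g^-1 x).                                   *)
Definition lact (g : G) (xi : G -> R) : G -> R := fun x => xi (ginv g *g x).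

Definition supported (H : G -> Prop) (xi : G -> R) : Prop :=
  forall x, ~ H x -> xi x = 0.

Definition l2 (xi : G -> R) : Prop :=
  exists M : R, forall F : seq G, uniq F -> \sum_(g <- F) xi g ^+ 2 <= M.

Definition vnorm_le1 (n : nat) (v : 'I_n -> G -> R) : Prop :=
  forall F : seq G, uniq F -> \sum_(i < n) \sum_(g <- F) v i g ^+ 2 <= 1.

Definition cocycle_vec (H : G -> Prop) (S : seq G) (v : 'I_(size S) -> G -> R) : Prop :=
  exists c : G -> G -> R,
    (forall g h, H g -> H h -> forall x, c (g *g h) x = c g x + lact g (c h) x) /\
    (forall i : 'I_(size S), c (nth (gone G) S i) = v i).

Definition coboundary_vec (H : G -> Prop) (S : seq G) (v : 'I_(size S) -> G -> R) : Prop :=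
  exists xi : G -> R, supported H xi /\ l2 xi /\
    forall (i : 'I_(size S)) x, v i x = lact (nth (gone G) S i) xi x - xi x.

(* von Neumann dimension over L(H) of a right-invariant subspace V of l^2(H)^n:
   sum_i <P_V delta_e^(i), delta_e^(i)> = sum_i ||P_V delta_e^(i)||^2, where
   ||P_V x|| = sup { <v, x> : v in V, ||v|| <= 1 } and <v, delta_e^(i)> = v_i(e). *)
Definition vN_dim (H : G -> Prop) (n : nat) (V : ('I_n -> G -> R) -> Prop) : R :=
  \sum_(i < n)
    (sup [set v i (gone G) | v in
          [set v | V v /\ (forall j, supported H (v j)) /\ vnorm_le1 v]]) ^+ 2.

(* beta_1^(2)(H) computed from the generating list S:
   dim (closure Z^1) - dim (closure B^1) = dim of reduced H^1(H, l^2 H) *)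
Definition beta1_with (H : G -> Prop) (S : seq G) : R :=
  @vN_dim H (size S) (@cocycle_vec H S) - @vN_dim H (size S) (@coboundary_vec H S).

(* first L^2-Betti number (independent of the generating list; we pick one) *)
Definition beta1 (H : G -> Prop) : R :=
  beta1_with H (epsilon (inhabits [::]) (generates H)).

Definition symmetric (S : seq G) : Prop := uniq S /\ forall s, s \in S -> ginv s \in S.

Definition boundary (S F : seq G) : nat :=
  \sum_(g <- F) count (fun s => (g *g s) \notin F) S.

Definition cheeger (S : seq G) : R :=
  inf [set (boundary S F)%:R / (size F)%:R |
        F in [set F : seq G | uniq F /\ F != [::]]].

Definition econst (S : seq G) : R := 1 - cheeger S / (size S)%:R.

Definition eta_quot (S : seq G) : R := ln (econst S) / ln (size S)%:R.

Definition group_finite : Prop := exists l : seq G, forall g : G, g \in l.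

Definition liminf_sym (f : seq G -> R) : \bar R :=
  ereal_sup [set ereal_inf [set (f S')%:E | S' in
                 [set S' : seq G | symmetric S' /\ {subset S <= S'}]] |
             S in [set S : seq G | symmetric S]].

Definition eta_grp : \bar R :=
  if `[< group_finite >] then -oo%E else (- liminf_sym eta_quot)%E.

End GroupDefs.

(* Main.v *)
(* Let p_s be the squared norm of the projection of the s-th unit vector onto the
   space of l^2-cocycles Z of Lambda, for s in a generating list S.  A cocycle is
   the gradient of a potential on Lambda, so p_s is the diagonal value at s of the
   reproducing kernel of the Dirichlet energy, and sum_s p_s = dim Z >= beta_1.
   By the trace property this sum does not depend on S, so S may be taken of minimal
   size r = rk(Lambda).  Gradients restricted to the edges inside a finite set F form
   a space of dimension at most |F|, whence
       sum_s p_s #{g in F : gs in F} <= |F|.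
   Thus T_c = {s : p_s >= c} spans finite subgraphs of average degree at most 2/c.  If
   eps > eta(Gamma), adding a fixed set S_0 to T_c and its inverses yields a set whose
   constant e is at least its cardinality to the power -eps, so
   c |T_c|^(1-eps) <= |S_0| + 2.  The n-th largest p_s is then O(n^(eps-1)), and
   summing gives beta_1 <= O(r^eps). *)
From Stdlib Require ClassicalEpsilon.
From Stdlib Require Import Rdefinitions.
Require Import Defs.
From HB Require Import structures.
From mathcomp Require Import all_boot all_order all_algebra.
From mathcomp Require Import all_classical all_reals all_analysis.
From mathcomp Require Import Rstruct ring lra.

Set Implicit Arguments.
Unset Strict Implicit.
Unset Printing Implicit Defensive.

Import Order.TTheory GRing.Theory Num.Theory.
Local Open Scope ring_scope.
(* Stdlib binds [R_scope] to [R]; without this, literals at type [R] parse as [IZR]. *)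
Bind Scope ring_scope with R.

(** * Real estimates *)

Section PowerSums.
Context {K : realType}.
Implicit Types (eps A : K) (q : seq K).

(** With [y = eps / N] one has [(1 - 1/N)^eps <= exp(-y) <= 1/(1+y) <= 1 - y/2], the last step
    because [y <= 1]; multiply by [N^eps]. *)
Lemma powR_succ_diff (n : nat) eps : 0 < eps -> eps <= 1 ->
  n%:R `^ eps + eps / 2 * n.+1%:R `^ (eps - 1) <= n.+1%:R `^ eps.
Proof.
move=> e0 e1; set N := n.+1%:R.
have N1 : 1 <= N by rewrite ler1n.
have N0 : 0 < N by exact: lt_le_trans N1.
set y := eps / N.
have y0 : 0 <= y by rewrite divr_ge0 // ltW.
have y1 : y <= 1 by rewrite ler_pdivrMr // mul1r (le_trans e1).
have nN : n%:R = N * (1 - N^-1).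
  by rewrite mulrBr mulr1 divff ?gt_eqF // /N -natr1 addrK.
have u0 : 0 <= 1 - N^-1 by rewrite subr_ge0 invf_le1.
have le_exp : (1 - N^-1) `^ eps <= expR (- y).
  apply: (le_trans (y := expR (- N^-1) `^ eps)).
    by apply: ge0_ler_powR; rewrite ?nnegrE ?expR_ge0 ?(ltW e0) ?expR_ge1Dx.
  by rewrite /powR gt_eqF ?expR_gt0 // expRK ler_expR /y mulrN.
have exp_le : expR (- y) <= 1 - y / 2.
  rewrite expRN; apply: (le_trans (y := (1 + y)^-1)).
    by rewrite lef_pV2 ?posrE ?expR_gt0 ?expR_ge1Dx //; lra.
  rewrite -[leLHS]mul1r ler_pdivrMr; last by lra.
  have : 0 <= y * (1 - y) by apply: mulr_ge0; lra.
  lra.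
have -> : N `^ (eps - 1) = N `^ eps / N.
  by rewrite powRB ?powRr1 ?(ltW N0) // (gt_eqF N0) implybT.
rewrite nN powRM ?(ltW N0) //.
have -> : eps / 2 * (N `^ eps / N) = N `^ eps * (y / 2) by rewrite /y; field; rewrite gt_eqF.
rewrite -mulrDr ler_piMr ?powR_ge0 //; lra.
Qed.

Lemma exists_min q : q != [::] -> exists2 x, x \in q & forall y, y \in q -> x <= y.
Proof.
elim: q => // a q ih _; have [->|/ih[x xq hx]] := eqVneq q [::].
  by exists a; rewrite ?mem_head // => y; rewrite inE => /eqP ->.
have [ax|xa] := leP a x.
  exists a; rewrite ?mem_head // => y; rewrite inE => /predU1P[->//|/hx].
  exact: le_trans.
exists x; first by rewrite inE xq orbT.
by move=> y; rewrite inE => /predU1P[->|/hx //]; exact: ltW.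
Qed.

(* The minimum [x] of [n] numbers satisfies [x <= A n^(eps-1)]; remove it and recurse. *)
Lemma sum_le_of_level_bound eps A q : 0 < eps -> eps <= 1 ->
  (forall x, x \in q -> 0 <= x) ->
  (forall x, x \in q -> x * (count (fun y => x <= y) q)%:R `^ (1 - eps) <= A) ->
  0 <= A -> \sum_(x <- q) x <= 2 * A / eps * (size q)%:R `^ eps.
Proof.
move=> e0 e1 + + A0; move: {2}(size q) (erefl (size q)) => n.
elim: n q => [|n ih] q sq q0 hq.
  by rewrite (size0nil sq) big_nil mulr_ge0 ?powR_ge0 // !mulr_ge0 // invr_ge0 ltW.
have [|x xq xmin] := @exists_min q; first by rewrite -size_eq0 sq.
have cx : count (fun y => x <= y) q = n.+1.
  by rewrite -sq; apply/eqP; rewrite -all_count; apply/allP => y /xmin.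
have N0 : 0 < n.+1%:R `^ (1 - eps) :> K by rewrite powR_gt0.
have le_x : x <= A * n.+1%:R `^ (eps - 1).
  by have := hq x xq; rewrite cx -(opprB eps 1) powRN -ler_pdivlMr ?invrK // invr_gt0 powR_gt0.
have sr : size (rem x q) = n by rewrite size_rem // sq.
have := ih (rem x q) sr (fun y yq => q0 y (mem_rem yq)) _.
have hr y : y \in rem x q -> y * (count (fun z => y <= z) (rem x q))%:R `^ (1 - eps) <= A.
  move=> yq; apply: le_trans (hq y (mem_rem yq)).
  apply: ler_wpM2l; first by apply: q0; exact: mem_rem yq.
  apply: ge0_ler_powR; rewrite ?nnegrE ?ler0n ?subr_ge0 // ler_nat.
  by rewrite leq_count_subseq // rem_subseq.
move=> /(_ hr) le_r; rewrite (big_rem _ xq) /= sq.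
have c0 : 0 <= 2 * A / eps by rewrite !mulr_ge0 // invr_ge0 ltW.
(* The factor [2 A / eps] makes the increment of the power at least [A (n+1)^(eps-1)], which bounds
   the removed minimum. *)
have := ler_wpM2l c0 (powR_succ_diff n e0 e1); rewrite mulrDr.
have -> : 2 * A / eps * (eps / 2 * n.+1%:R `^ (eps - 1)) = A * n.+1%:R `^ (eps - 1).
  by field; rewrite gt_eqF.
by move: le_r; rewrite sr; lra.
Qed.

End PowerSums.

(** Removes an error linear in [d] by letting [d] tend to 0; restricting to [d <= 1] lets [d^2] be
    absorbed into [d] beforehand. *)
Lemma le_of_le_linear (a b c : R) : (forall d, 0 < d -> d <= 1 -> a <= b + c * d) -> a <= b.
Proof.
move=> h; apply/ler_addgt0Pr => eps eps0.
have c1 : 0 < `|c| + 1 by rewrite ltr_wpDl.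
pose d := Num.min 1 (eps / (`|c| + 1)).
have d0 : 0 < d by rewrite lt_min ltr01 divr_gt0.
apply: le_trans (h d d0 _) _; first by rewrite ge_min lexx.
rewrite lerD2l; apply: (le_trans (y := (`|c| + 1) * d)).
  by rewrite ler_pM2r //; have := ler_norm c; lra.
by rewrite mulrC -ler_pdivlMr // ge_min lexx orbT.
Qed.

(** Collects the errors of the limit passage in [energy_minimizer]: [c] is the convergence rate at
    the target edge and [q] a finite sum of squared rates. *)
Lemma quadratic_error_le (b c q d : R) : 0 <= c -> 0 <= q -> 0 < d -> d <= 1 ->
  (1 + d) * (b + (d ^+ 2 + 2 * c * d)) + (d + d ^+ 2) * q <=
  b + (`|b| + 2 * (1 + 2 * c) + 2 * q) * d.
Proof.
move=> c0 q0 d0 d1; have d2 : d ^+ 2 <= d by rewrite expr2 ler_piMr // ltW.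
have e1 : d * b <= d * `|b| by rewrite ler_pM2l // ler_norm.
have e2 : (d + d ^+ 2) * q <= 2 * d * q by apply: ler_wpM2r => //; lra.
have e3 : (1 + d) * (d ^+ 2 + 2 * c * d) <= 2 * ((1 + 2 * c) * d).
  apply: ler_pM => //; [lra | | lra | nra].
  by apply: addr_ge0; [exact: sqr_ge0 | rewrite !mulr_ge0 // ltW].
lra.
Qed.

(** Every [f d' + c d'] bounds all [f d - c d] from above, so the supremum of the latter is a limit
    with the same rate. *)
Lemma linear_rate_limit (f : R -> R) (c : R) :
  (forall d d', 0 < d -> 0 < d' -> `|f d - f d'| <= c * (d + d')) ->
  exists l, forall d, 0 < d -> `|f d - l| <= c * d.
Proof.
move=> h; pose A := [set f d - c * d | d in [set d | 0 < d]]%classic.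
have ubA d' : 0 < d' -> ubound A (f d' + c * d').
  move=> d'0 _ [d /= d0 <-]; have := h _ _ d0 d'0.
  by rewrite ler_norml => /andP[]; lra.
have hA : has_sup A.
  split; last by exists (f 1 + c * 1); exact: ubA.
  by exists (f 1 - c * 1); exists 1 => //=; exact: ltr01.
exists (sup A) => d d0.
have u1 : sup A <= f d + c * d by apply: ge_sup (ubA _ d0); case: hA.
have u2 : f d - c * d <= sup A by apply: sup_upper_bound => //; exists d.
by rewrite ler_norml; apply/andP; split; lra.
Qed.

(** * Unconditional sums *)

Section UnconditionalSums.
Context {K : realType} {T : eqType}.
Implicit Types (f g : T -> K) (F : seq T).

(** Convergence along the net of finite subsets, since the index type may be uncountable. Only
    membership in [F0] matters, so it may repeat entries. *)
Definition has_sum f (l : K) := forall e, 0 < e ->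
  exists F0, forall F, uniq F -> {subset F0 <= F} -> `|\sum_(x <- F) f x - l| <= e.

Definition summable f := exists l, has_sum f l.

Definition tsum f : K := xget 0 [set l | has_sum f l]%classic.

Lemma has_sum_unique f l l' : has_sum f l -> has_sum f l' -> l = l'.
Proof.
move=> hl hl'; apply/eqP; rewrite -subr_eq0 -normr_le0; apply/ler_addgt0Pr => e e0.
have e2 : 0 < e / 2 by lra.
have [F1 h1] := hl _ e2; have [F2 h2] := hl' _ e2.
pose F := undup (F1 ++ F2).
have s1 : {subset F1 <= F} by move=> x xF; rewrite mem_undup mem_cat xF.
have s2 : {subset F2 <= F} by move=> x xF; rewrite mem_undup mem_cat xF orbT.
have k1 := h1 F (undup_uniq _) s1; have k2 := h2 F (undup_uniq _) s2.
move: k1 k2; rewrite !ler_norml => /andP[a1 a2] /andP[a3 a4].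
by apply/andP; split; lra.
Qed.

Lemma has_sum_tsum f : summable f -> has_sum f (tsum f).
Proof. by move=> sf; exact: (xgetPex 0 sf). Qed.

Lemma tsumE f l : has_sum f l -> tsum f = l.
Proof. by move=> fl; apply: (has_sum_unique _ fl); apply: has_sum_tsum; exists l. Qed.

Lemma has_sumD f g a b : has_sum f a -> has_sum g b ->
  has_sum (fun x => f x + g x) (a + b).
Proof.
move=> ha hb e e0; have e2 : 0 < e / 2 by lra.
have [F1 h1] := ha _ e2; have [F2 h2] := hb _ e2.
exists (F1 ++ F2) => F uF sF; rewrite big_split /=.
have s1 : {subset F1 <= F} by move=> x xF; apply: sF; rewrite mem_cat xF.
have s2 : {subset F2 <= F} by move=> x xF; apply: sF; rewrite mem_cat xF orbT.
have := h1 F uF s1; have := h2 F uF s2.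
rewrite !ler_norml => /andP[a1 a2] /andP[a3 a4].
by apply/andP; split; lra.
Qed.

Lemma has_sumZ c f a : has_sum f a -> has_sum (fun x => c * f x) (c * a).
Proof.
move=> ha e e0; have d0 : 0 < e / (`|c| + 1) by rewrite divr_gt0 // ltr_wpDl.
have [F1 h1] := ha _ d0; exists F1 => F uF sF.
rewrite -mulr_sumr -mulrBr normrM.
have := h1 F uF sF; rewrite ler_pdivlMr ?ltr_wpDl //.
have := normr_ge0 c; have := normr_ge0 (\sum_(x <- F) f x - a); nra.
Qed.

Lemma summableD f g : summable f -> summable g -> summable (fun x => f x + g x).
Proof. by move=> [a ha] [b hb]; exists (a + b); exact: has_sumD. Qed.

Lemma summableZ c f : summable f -> summable (fun x => c * f x).
Proof. by move=> [a ha]; exists (c * a); exact: has_sumZ. Qed.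

Lemma tsumD f g : summable f -> summable g ->
  tsum (fun x => f x + g x) = tsum f + tsum g.
Proof. by move=> sf sg; apply: tsumE; apply: has_sumD; exact: has_sum_tsum. Qed.

Lemma tsumZ c f : summable f -> tsum (fun x => c * f x) = c * tsum f.
Proof. by move=> sf; apply: tsumE; apply: has_sumZ; exact: has_sum_tsum. Qed.

Lemma has_sum0 : has_sum (fun=> 0) 0.
Proof. by move=> e e0; exists [::] => F _ _; rewrite big1 // subr0 normr0 ltW. Qed.

Lemma has_sum_sum (I : eqType) (r : seq I) (f : I -> T -> K) :
  (forall i, i \in r -> summable (f i)) ->
  has_sum (fun x => \sum_(i <- r) f i x) (\sum_(i <- r) tsum (f i)).
Proof.
elim: r => [|i r ih] h.
  rewrite big_nil; under eq_fun do rewrite big_nil; exact: has_sum0.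
rewrite big_cons; under eq_fun do rewrite big_cons.
apply: has_sumD; first by apply: has_sum_tsum; apply: h; rewrite mem_head.
by apply: ih => j jr; apply: h; rewrite inE jr orbT.
Qed.

Lemma sum_subset_le f F F' : (forall x, 0 <= f x) -> uniq F -> uniq F' ->
  {subset F <= F'} -> \sum_(x <- F) f x <= \sum_(x <- F') f x.
Proof.
move=> f0 uF uF' sF; rewrite [X in _ <= X](bigID (mem F) predT) /=.
suff pF : perm_eq [seq x <- F' | x \in F] F.
  by rewrite -[X in _ <= X + _]big_filter (perm_big _ pF) lerDl sumr_ge0.
apply: uniq_perm => //; first by rewrite filter_uniq.
by move=> x; rewrite mem_filter; case: (boolP (x \in F)) => // /sF ->.
Qed.

Lemma summable_ge0 f (M : K) : (forall x, 0 <= f x) ->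
  (forall F, uniq F -> \sum_(x <- F) f x <= M) -> summable f.
Proof.
move=> f0 fM; pose A := [set \sum_(x <- F) f x | F in [set F : seq T | uniq F]]%classic.
have hA : has_sup A.
  split; first by exists 0; exists [::] => //; rewrite big_nil.
  by exists M => _ [F uF <-]; exact: fM.
exists (sup A) => e e0.
have [_ [F0 uF0 <-] hF0] := sup_adherent e0 hA.
exists F0 => F uF sF.
have le1 : \sum_(x <- F) f x <= sup A by apply: sup_upper_bound => //; exists F.
have le2 := sum_subset_le f0 uF0 uF sF.
by rewrite ler_norml; apply/andP; split; lra.
Qed.

Lemma tsum_le f (M : K) : summable f ->
  (forall F, uniq F -> \sum_(x <- F) f x <= M) -> tsum f <= M.
Proof.
move=> /has_sum_tsum sf fM; apply/ler_addgt0Pr => e e0.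
have [F0 h] := sf _ e0.
have s0 : {subset F0 <= undup F0} by move=> x; rewrite mem_undup.
have := h _ (undup_uniq _) s0; have := fM _ (undup_uniq F0).
by rewrite ler_norml => ? /andP[]; lra.
Qed.

Lemma le_tsum f F : summable f -> (forall x, 0 <= f x) -> uniq F ->
  \sum_(x <- F) f x <= tsum f.
Proof.
move=> /has_sum_tsum sf f0 uF; apply/ler_addgt0Pr => e e0.
have [F0 h] := sf _ e0.
have sub1 : {subset F0 <= undup (F ++ F0)}.
  by move=> x xF; rewrite mem_undup mem_cat xF orbT.
have := h _ (undup_uniq _) sub1.
have sub2 : {subset F <= undup (F ++ F0)} by move=> x xF; rewrite mem_undup mem_cat xF.
have := sum_subset_le f0 uF (undup_uniq _) sub2.
by rewrite ler_norml => ? /andP[]; lra.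
Qed.

Lemma tsum_ge0 f : (forall x, 0 <= f x) -> summable f -> 0 <= tsum f.
Proof. by move=> f0 sf; have := le_tsum sf f0 (isT : uniq [::]); rewrite big_nil. Qed.

Lemma has_sum_reindex (p q : T -> T) f l : cancel p q -> cancel q p ->
  has_sum f l -> has_sum (f \o p) l.
Proof.
move=> pq qp fl e e0; have [F0 h] := fl _ e0.
exists (map q F0) => F uF sF.
rewrite -(big_map p predT f); apply: h; first by rewrite map_inj_uniq //; exact: can_inj pq.
by move=> x xF; rewrite -[x]qp map_f // sF // map_f.
Qed.

Lemma summable_reindex (p q : T -> T) f : cancel p q -> cancel q p ->
  summable f -> summable (f \o p).
Proof. by move=> pq qp [l fl]; exists l; exact: has_sum_reindex fl. Qed.

Lemma tsum_reindex (p q : T -> T) f : cancel p q -> cancel q p ->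
  summable f -> tsum (f \o p) = tsum f.
Proof. by move=> pq qp sf; apply: tsumE; apply: (has_sum_reindex pq qp); exact: has_sum_tsum. Qed.

Definition sqsummable f := summable (fun x => f x ^+ 2).

Definition dot f g : K := tsum (fun x => f x * g x).

Lemma sqsummable_bounded f (M : K) :
  (forall F, uniq F -> \sum_(x <- F) f x ^+ 2 <= M) -> sqsummable f.
Proof. by apply: summable_ge0 => x; exact: sqr_ge0. Qed.

Lemma dotC f g : dot f g = dot g f.
Proof. by rewrite /dot; under eq_fun do rewrite mulrC. Qed.

Lemma dot_ge0 f : sqsummable f -> 0 <= dot f f.
Proof.
by move=> sf; rewrite /dot; under eq_fun do rewrite -expr2; apply: tsum_ge0 => // x; exact: sqr_ge0.
Qed.

Lemma sum_sq_le_dot f F : sqsummable f -> uniq F -> \sum_(x <- F) f x ^+ 2 <= dot f f.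
Proof.
move=> sf uF; rewrite /dot; under [X in tsum X]eq_fun do rewrite -expr2.
by apply: le_tsum => // x; exact: sqr_ge0.
Qed.

Lemma sq_le_dot f x : sqsummable f -> f x ^+ 2 <= dot f f.
Proof. by move=> sf; have := sum_sq_le_dot sf (isT : uniq [:: x]); rewrite big_seq1. Qed.

Lemma dot_le f (M : K) : (forall F, uniq F -> \sum_(x <- F) f x ^+ 2 <= M) -> dot f f <= M.
Proof.
move=> h; rewrite /dot; under eq_fun do rewrite -expr2.
by apply: tsum_le => //; exact: sqsummable_bounded h.
Qed.

Lemma sum_sqD_le f g F : sqsummable f -> sqsummable g -> uniq F ->
  \sum_(x <- F) (f x + g x) ^+ 2 <= 2 * dot f f + 2 * dot g g.
Proof.
move=> sf sg uF.
apply: (le_trans (y := \sum_(x <- F) (2 * f x ^+ 2 + 2 * g x ^+ 2))).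
  by apply: ler_sum => x _; have := sqr_ge0 (f x - g x); lra.
rewrite big_split /= -!mulr_sumr; have := sum_sq_le_dot sf uF; have := sum_sq_le_dot sg uF.
lra.
Qed.

Lemma sqsummableD f g : sqsummable f -> sqsummable g -> sqsummable (fun x => f x + g x).
Proof. by move=> sf sg; apply: sqsummable_bounded => F; exact: sum_sqD_le. Qed.

Lemma dotDD_le f g : sqsummable f -> sqsummable g ->
  dot (fun x => f x + g x) (fun x => f x + g x) <= 2 * dot f f + 2 * dot g g.
Proof. by move=> sf sg; apply: dot_le => F; exact: sum_sqD_le. Qed.

Lemma sqsummableZ c f : sqsummable f -> sqsummable (fun x => c * f x).
Proof.
by move=> sf; rewrite /sqsummable; under eq_fun do rewrite exprMn; exact: summableZ.
Qed.

Lemma summable_mul f g : sqsummable f -> sqsummable g -> summable (fun x => f x * g x).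
Proof.
move=> sf sg.
(* Polarization reduces products to squares. *)
have -> : (fun x => f x * g x) =
    (fun x => 2^-1 * ((f x + g x) ^+ 2 + (-1) * (f x ^+ 2 + g x ^+ 2))).
  by apply/funext => x; field.
by apply/summableZ/summableD; [exact: sqsummableD | apply/summableZ/summableD].
Qed.

Lemma dotDl f g h : sqsummable f -> sqsummable g -> sqsummable h ->
  dot (fun x => f x + g x) h = dot f h + dot g h.
Proof.
move=> sf sg sh; rewrite /dot; under eq_fun do rewrite mulrDl.
by rewrite tsumD //; exact: summable_mul.
Qed.

Lemma dotZl c f h : sqsummable f -> sqsummable h ->
  dot (fun x => c * f x) h = c * dot f h.
Proof.
move=> sf sh; rewrite /dot; under eq_fun do rewrite -mulrA.
by rewrite tsumZ //; exact: summable_mul.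
Qed.

Lemma sqsummable_reindex (p q : T -> T) f : cancel p q -> cancel q p ->
  sqsummable f -> sqsummable (fun x => f (p x)).
Proof. exact: (@summable_reindex p q (fun x => f x ^+ 2)). Qed.

Lemma dot_reindex (p q : T -> T) f g : cancel p q -> cancel q p ->
  sqsummable f -> sqsummable g ->
  dot (fun x => f (p x)) (fun x => g (p x)) = dot f g.
Proof.
by move=> pq qp sf sg; apply: (tsum_reindex (f := fun x => f x * g x) pq qp); exact: summable_mul.
Qed.

End UnconditionalSums.

(** * Gram-Schmidt *)

Section FiniteFrames.
Context {K : realType} {X : Type} (E : seq X).
Implicit Types (f g : X -> K).

Definition fdot f g := \sum_(a <- E) f a * g a.

Lemma fdotC f g : fdot f g = fdot g f.
Proof. by apply: eq_bigr => a _; rewrite mulrC. Qed.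

Lemma fdot_suml (J : Type) (r : seq J) (c : J -> K) (f : J -> X -> K) g :
  fdot (fun a => \sum_(j <- r) c j * f j a) g = \sum_(j <- r) c j * fdot (f j) g.
Proof.
rewrite /fdot; under eq_bigr do rewrite mulr_suml.
rewrite exchange_big /=; apply: eq_bigr => j _; rewrite mulr_sumr.
by apply: eq_bigr => a _; rewrite mulrA.
Qed.
End FiniteFrames.

Section GramSchmidt.
Context {K : realType} {X : eqType} (E : seq X).
Implicit Types (f g : X -> K) (o : nat -> X -> K).

(** Membership in the span on [E], stated through the Fourier formula so that it still makes sense
    when some [o j] vanish. *)
Definition expands d o f :=
  forall a, a \in E -> f a = \sum_(0 <= j < d) fdot E f (o j) * o j a.

Lemma eq_fdotl f f' g : {in E, f =1 f'} -> fdot E f g = fdot E f' g.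
Proof. by move=> ff'; apply: eq_big_seq => a /ff' ->. Qed.

Lemma expands_lin d o (I : eqType) (r : seq I) (c : I -> K) (f : I -> X -> K) :
  (forall i, i \in r -> expands d o (f i)) ->
  expands d o (fun a => \sum_(i <- r) c i * f i a).
Proof.
move=> h a aE; rewrite (eq_big_seq (fun i =>
    \sum_(0 <= j < d) c i * (fdot E (f i) (o j) * o j a))); last first.
  by move=> i ir; rewrite (h _ ir _ aE) mulr_sumr.
rewrite exchange_big /=; apply: eq_bigr => j _.
by rewrite fdot_suml mulr_suml; apply: eq_bigr => i _; rewrite mulrA.
Qed.

(** Expanding [g] turns [<f, g>] into [sum_j <g, o_j> <o_j, f>], which is also the product of [g]
    with the expansion of [f]. *)
Lemma fdot_residual d o f g : expands d o g ->
  fdot E (fun a => f a - \sum_(0 <= j < d) fdot E f (o j) * o j a) g = 0.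
Proof.
move=> hg; rewrite /fdot; under eq_bigr do rewrite mulrBl.
rewrite sumrB -/(fdot E f g) -/(fdot E (fun a => \sum_(0 <= j < d) fdot E f (o j) * o j a) g).
have -> : fdot E f g = \sum_(0 <= j < d) fdot E g (o j) * fdot E (o j) f.
  by rewrite fdotC (eq_fdotl _ hg) fdot_suml.
rewrite fdot_suml -sumrB big1 // => j _.
by rewrite [fdot E (o j) f]fdotC [fdot E g _]fdotC mulrC subrr.
Qed.

(* Vanishing vectors are allowed among the [o j], so no rank has to be computed. *)
Lemma Gram_Schmidt (I : eqType) (r : seq I) (w : I -> X -> K) :
  exists o, [/\ forall j, fdot E (o j) (o j) <= 1,
    forall j, expands (size r) o (o j) &
    forall i, i \in r -> expands (size r) o (w i)].
Proof.
elim: r => [|v r [ o [ o1 oo ow]]] /=.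
  exists (fun _ _ => 0); split=> // [j|j a _].
    by rewrite /fdot big1 ?ler01 // => a _; rewrite mul0r.
  by rewrite big_nil.
set d := size r in oo ow *.
pose res a := w v a - \sum_(0 <= j < d) fdot E (w v) (o j) * o j a.
(* If the residual vanishes on [E], then [n = 0] and, as the inverse of 0 is 0, also [c = 0]; [cn]
   treats both cases at once. *)
pose n := fdot E res res; pose c := (Num.sqrt n)^-1.
have n0 : 0 <= n by apply: sumr_ge0 => a _; rewrite -expr2 sqr_ge0.
pose o' j a := if (j < d)%N then o j a else c * res a.
have o'o j : (j < d)%N -> o' j = o j by rewrite /o' => ->.
have o'd j : (d <= j)%N -> o' j = fun a => c * res a by rewrite /o' ltnNge => ->.
have fdotZ (b : K) f g : fdot E (fun a => b * f a) g = b * fdot E f g.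
  by rewrite /fdot mulr_sumr; apply: eq_bigr => a _; rewrite mulrA.
have resE f : expands d o f -> fdot E res f = 0 by exact: fdot_residual.
have cn : c * (c * n) = (n != 0)%:R.
  have [n0'|n0'] := eqVneq n 0; first by rewrite n0' !mulr0.
  by rewrite mulrA -expr2 /c exprVn sqr_sqrtr // mulVf.
have res0 a : a \in E -> n = 0 -> res a = 0.
  move=> aE /eqP; rewrite /n /fdot psumr_eq0 => [/allP/(_ a aE)/=|b _]; last first.
    by rewrite -expr2 sqr_ge0.
  by rewrite mulf_eq0 orbb => /eqP.
have split f a : \sum_(0 <= j < d.+1) fdot E f (o' j) * o' j a =
    \sum_(0 <= j < d) fdot E f (o j) * o j a + c * (c * fdot E f res) * res a.
  rewrite big_nat_recr //= (o'd d) // [fdot E f (fun a => _)]fdotC fdotZ [fdot E res f]fdotC.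
  congr (_ + _); last by ring.
  by rewrite !big_nat; apply: eq_bigr => j /andP[_ jd]; rewrite o'o.
(* Old vectors are orthogonal to the residual, so the new term of their expansion is zero. *)
have keep f : expands d o f -> expands d.+1 o' f.
  move=> hf a aE; rewrite split [fdot E f res]fdotC resE // !mulr0 mul0r addr0; exact: hf.
have keep_res : expands d.+1 o' res.
  move=> a aE; rewrite split big1 ?add0r => [|j _]; last by rewrite resE ?mul0r.
  rewrite -/n cn; have [/(res0 _ aE) ->|_] := eqVneq n 0; first by rewrite mulr0.
  by rewrite mul1r.
exists o'; split=> [j|j|i].
- have [jd|jd] := ltnP j d; rewrite ?(o'o _ jd) ?(o'd _ jd); first exact: o1.
  by rewrite fdotZ fdotC fdotZ -/n cn lern1 leq_b1.
- have [jd|jd] := ltnP j d; rewrite ?(o'o _ jd) ?(o'd _ jd); first by apply: keep.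
  have := @expands_lin d.+1 o' unit [:: tt] (fun=> c) (fun=> res) (fun _ _ => keep_res).
  by under eq_fun do rewrite big_seq1.
rewrite inE => /predU1P[->|/ow]; last exact: keep.
move=> a aE; rewrite split.
(* [w v] differs from the residual by a combination of the old [o j], to which the residual is
   orthogonal. *)
have -> : fdot E (w v) res = n.
  have -> : fdot E (w v) res = fdot E (fun a => res a + (w v a - res a)) res.
    by apply: eq_fdotl => b _; rewrite addrC subrK.
  rewrite /fdot; under eq_bigr do rewrite mulrDl.
  rewrite big_split /= -/(fdot E res res) -/n.
  rewrite -/(fdot E (fun a => w v a - res a) res) (_ : fdot _ _ res = 0) ?addr0 //.
  have -> : (fun a => w v a - res a) = fun a => \sum_(0 <= j < d) fdot E (w v) (o j) * o j a.
    by apply/funext => b; rewrite /res opprB addrC subrK.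
  by rewrite fdotC; apply: resE; exact: expands_lin.
rewrite cn -[w v a](subrK (\sum_(0 <= j < d) fdot E (w v) (o j) * o j a)) -/(res a).
rewrite addrC; congr (_ + _); have [/(res0 _ aE) ->|_] := eqVneq n 0; first by rewrite mulr0.
by rewrite mul1r.
Qed.

End GramSchmidt.

(** * Dirichlet energy on Cayley graphs *)

Section CayleyEnergy.
Variable G : AbsGroup.
Implicit Types (S : seq G) (H : G -> Prop) (xi zeta : G -> R) (g h x y : G).

Local Notation "x *g y" := (gmul x y) (at level 40, left associativity).

Lemma gmulKl x y : ginv x *g (x *g y) = y.
Proof. by rewrite gmulA gVmul gone_mul. Qed.

Lemma gmulVKl x y : x *g (ginv x *g y) = y.
Proof. by rewrite gmulA gmulV gone_mul. Qed.

Lemma gmulKr x y : x *g y *g ginv y = x.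
Proof. by rewrite -gmulA gmulV gmul1. Qed.

Lemma gmulVKr x y : x *g ginv y *g y = x.
Proof. by rewrite -gmulA gVmul gmul1. Qed.

Lemma ginv_uniq x y : x *g y = gone G -> y = ginv x.
Proof. by move=> xy; rewrite -(gmulKl x y) xy gmul1. Qed.

Lemma ginvK x : ginv (ginv x) = x.
Proof. by apply/esym/ginv_uniq; rewrite gVmul. Qed.

Lemma ginvM x y : ginv (x *g y) = ginv y *g ginv x.
Proof. by apply/esym/ginv_uniq; rewrite -gmulA gmulVKl gmulV. Qed.

Lemma ginv1 : ginv (gone G) = gone G.
Proof. by apply/esym/ginv_uniq; rewrite gmul1. Qed.

(* The Cayley edge from [g] to [g *g s] is indexed by the pair [(s, ginv g)]: on it,
   [fun y => xi (ginv y)] increases by [gdiff s xi (ginv g)]. *)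
Definition gdiff g xi x := lact g xi x - xi x.

Lemma gdiff1 xi x : gdiff (gone G) xi x = 0.
Proof. by rewrite /gdiff /lact ginv1 gone_mul subrr. Qed.

Lemma gdiffM g h xi x : gdiff (g *g h) xi x = gdiff h xi (ginv g *g x) + gdiff g xi x.
Proof. by rewrite /gdiff /lact ginvM gmulA; ring. Qed.

Lemma gdiffV g xi x : gdiff (ginv g) xi x = (-1) * gdiff g xi (g *g x).
Proof. by rewrite /gdiff /lact ginvK gmulKl; ring. Qed.

Lemma gdiff_lin (a b : R) g xi zeta x :
  gdiff g (fun x => a * xi x + b * zeta x) x = a * gdiff g xi x + b * gdiff g zeta x.
Proof. by rewrite /gdiff /lact; ring. Qed.

Lemma gdiff_rtrans g y xi x : gdiff g (fun x => xi (x *g y)) x = gdiff g xi (x *g y).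
Proof. by rewrite /gdiff /lact gmulA. Qed.

Definition finite_energy S xi := forall s, s \in S -> sqsummable (gdiff s xi).

Definition energy S xi zeta : R := \sum_(s <- S) dot (gdiff s xi) (gdiff s zeta).

Lemma finite_energy_lin S (a b : R) xi zeta : finite_energy S xi -> finite_energy S zeta ->
  finite_energy S (fun x => a * xi x + b * zeta x).
Proof.
move=> fx fz s sS; rewrite (_ : gdiff _ _ = fun x => a * gdiff s xi x + b * gdiff s zeta x).
  by apply: sqsummableD; apply: sqsummableZ; auto.
by apply/funext => x; exact: gdiff_lin.
Qed.

Lemma energy_linl S (a b : R) xi zeta eta :
  finite_energy S xi -> finite_energy S zeta -> finite_energy S eta ->
  energy S (fun x => a * xi x + b * zeta x) eta = a * energy S xi eta + b * energy S zeta eta.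
Proof.
move=> fx fz fe; rewrite /energy !mulr_sumr -big_split /=.
apply: eq_big_seq => s sS.
rewrite (_ : gdiff s (fun x => _) = fun x => a * gdiff s xi x + b * gdiff s zeta x).
  by rewrite dotDl ?dotZl //; auto; apply: sqsummableZ; auto.
by apply/funext => x; exact: gdiff_lin.
Qed.

Lemma energyC S xi zeta : energy S xi zeta = energy S zeta xi.
Proof. by apply: eq_bigr => s _; exact: dotC. Qed.

Lemma energy_lin2 S (a b : R) xi zeta : finite_energy S xi -> finite_energy S zeta ->
  energy S (fun x => a * xi x + b * zeta x) (fun x => a * xi x + b * zeta x) =
  a ^+ 2 * energy S xi xi + 2 * a * b * energy S xi zeta + b ^+ 2 * energy S zeta zeta.
Proof.
move=> fx fz; have fl := finite_energy_lin a b fx fz.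
rewrite energy_linl // energyC energy_linl // [X in _ + _ * X]energyC energy_linl //.
by rewrite [energy S zeta xi]energyC; ring.
Qed.

Lemma energy_ge0 S xi : finite_energy S xi -> 0 <= energy S xi xi.
Proof. by move=> fx; rewrite /energy big_seq sumr_ge0 // => s sS; apply: dot_ge0; exact: fx. Qed.

Lemma dot_le_energy S xi s : finite_energy S xi -> s \in S ->
  dot (gdiff s xi) (gdiff s xi) <= energy S xi xi.
Proof.
move=> fx sS; rewrite /energy (big_rem _ sS) /= lerDl big_seq sumr_ge0 // => t /mem_rem tS.
by apply: dot_ge0; exact: fx.
Qed.

Lemma sum_sq_le_energy S xi F : finite_energy S xi -> uniq F ->
  \sum_(s <- S) \sum_(x <- F) gdiff s xi x ^+ 2 <= energy S xi xi.
Proof.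
move=> fx uF; rewrite /energy big_seq [leRHS]big_seq; apply: ler_sum => s sS.
by apply: sum_sq_le_dot => //; exact: fx.
Qed.

(** The bound on partial sums first controls each direction [s], the other terms being nonnegative;
    then the total energy is one sum over the group of finite sums over [S]. *)
Lemma finite_energy_bounded S xi (M : R) :
  (forall F, uniq F -> \sum_(s <- S) \sum_(x <- F) gdiff s xi x ^+ 2 <= M) ->
  finite_energy S xi /\ energy S xi xi <= M.
Proof.
move=> h; have fx : finite_energy S xi.
  move=> s sS; apply: (sqsummable_bounded (M := M)) => F uF; apply: le_trans (h F uF).
  rewrite (big_rem _ sS) /= lerDl sumr_ge0 // => t _.
  by rewrite sumr_ge0 // => x _; exact: sqr_ge0.
split=> //; have := has_sum_sum (r := S) (f := fun s x => gdiff s xi x ^+ 2) fx.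
move=> hs; have -> : energy S xi xi = tsum (fun x => \sum_(s <- S) gdiff s xi x ^+ 2).
  rewrite (tsumE hs); apply: eq_bigr => s _.
  by rewrite /dot; under eq_fun do rewrite -expr2.
apply: tsum_le; first by eexists; exact: hs.
by move=> F uF; rewrite exchange_big /=; exact: h.
Qed.

(** The [g] admitting such a [C] form a subgroup containing [S], hence all of [H]. Consequently
    finite energy does not depend on the generators, and differences along [H] are continuous for
    the energy. *)
Lemma gdiff_bounded S H g : generates H S -> H g ->
  exists2 C : R, 0 < C & forall xi, finite_energy S xi ->
    sqsummable (gdiff g xi) /\ dot (gdiff g xi) (gdiff g xi) <= C * energy S xi xi.
Proof.
move=> [_ [_ minH]]; move: g.
pose K g := exists2 C : R, 0 < C & forall xi, finite_energy S xi ->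
  sqsummable (gdiff g xi) /\ dot (gdiff g xi) (gdiff g xi) <= C * energy S xi xi.
apply: (minH K) => [|s sS]; last first.
  exists 1 => // xi fx; split; first exact: fx.
  by rewrite mul1r; exact: dot_le_energy.
split.
- exists 1 => // xi fx; have -> : gdiff (gone G) xi = fun=> 0 by apply/funext => x; exact: gdiff1.
  have h (F : seq G) : uniq F -> \sum_(x <- F) (fun=> 0) x ^+ 2 <= 0 :> R.
    by rewrite big1 // => *; rewrite expr0n.
  split; first exact: sqsummable_bounded h.
  apply: (le_trans (dot_le h)).
  by rewrite mul1r energy_ge0.
- move=> g h [C C0 hC] [D D0 hD]; exists (2 * D + 2 * C); first by lra.
  move=> xi fx; have [sg le_g] := hC xi fx; have [sh le_h] := hD xi fx.
  have -> : gdiff (g *g h) xi = fun x => gdiff h xi (ginv g *g x) + gdiff g xi x.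
    by apply/funext => x; exact: gdiffM.
  have sh' := sqsummable_reindex (gmulVKl g) (gmulKl g) sh.
  split; first exact: sqsummableD.
  apply: le_trans (dotDD_le sh' sg) _.
  by rewrite (dot_reindex (gmulVKl g) (gmulKl g) sh sh); lra.
- move=> g [C C0 hC]; exists C => // xi fx; have [sg le_g] := hC xi fx.
  have -> : gdiff (ginv g) xi = fun x => (-1) * gdiff g xi (g *g x).
    by apply/funext => x; exact: gdiffV.
  have sg' := sqsummable_reindex (gmulKl g) (gmulVKl g) sg.
  split; first exact: sqsummableZ.
  rewrite dotZl ?[dot _ (fun x => -1 * _)]dotC ?dotZl //; last exact: sqsummableZ.
  by rewrite mulrA mulrNN !mul1r (dot_reindex (gmulKl g) (gmulVKl g) sg sg).
Qed.

(** * Existence of reproducing kernels *)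

Lemma finite_energy0 S : finite_energy S (fun=> 0).
Proof.
move=> s _; apply: (@sqsummable_bounded _ _ _ 0) => F _.
by rewrite big1 // => x _; rewrite /gdiff /lact subrr expr0n.
Qed.

(** Direct method for the functional [J]: a minimizing family is Cauchy in energy by the
    parallelogram law, its values relative to the identity converge on [H], and lower semicontinuity
    on finite sets of edges shows that the limit is a minimizer. *)
Lemma energy_minimizer S H h : generates H S -> H h ->
  exists k, [/\ supported H k, finite_energy S k & forall xi, finite_energy S xi ->
    energy S k k - 2 * gdiff h k (gone G) <= energy S xi xi - 2 * gdiff h xi (gone G)].
Proof.
move=> genS Hh; have [[H1 HM HV] [SH _]] := genS.
pose J xi := energy S xi xi - 2 * gdiff h xi (gone G).
pose A := [set J xi | xi in finite_energy S]%classic.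
have hA : has_inf A.
  split; first by exists (J (fun=> 0)); exists (fun=> 0) => //; exact: finite_energy0.
  have [C C0 hC] := gdiff_bounded genS Hh.
  exists (- C) => _ [xi /= fx <-]; have [sx le_x] := hC xi fx.
  have le_a := le_trans (sq_le_dot (gone G) sx) le_x.
  (* With [a] the difference at the identity, [C * J xi >= a^2 - 2 C a >= - C^2]. *)
  rewrite -(ler_pM2l C0) /J; have := sqr_ge0 (gdiff h xi (gone G) - C); nra.
pose m := inf A.
have mJ xi : finite_energy S xi -> m <= J xi.
  by move=> fx; apply: ge_inf; [case: hA | exists xi].
have [X hX] : exists X : R -> G -> R, forall d, 0 < d ->
    finite_energy S (X d) /\ J (X d) <= m + d ^+ 2.
  have /choice[X hX] : forall d : R, exists xi : G -> R, 0 < d ->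
      finite_energy S xi /\ J xi <= m + d ^+ 2.
    move=> d; have [d0|] := boolP (0 < d); last by exists (fun=> 0).
    have [_ [xi fx <-] /ltW lt_m] := inf_adherent (exprn_gt0 2 d0) hA.
    by exists xi.
  by exists X.
(* [J] is at least [m] at the midpoint, so the energy of the difference is at most
   [2 (J (X d) + J (X d') - 2 m)]. *)
have parallelogram d d' : 0 < d -> 0 < d' ->
    finite_energy S (fun x => 1 * X d x + (-1) * X d' x) /\
    energy S (fun x => 1 * X d x + (-1) * X d' x) (fun x => 1 * X d x + (-1) * X d' x)
      <= 2 * (d ^+ 2 + d' ^+ 2).
  move=> /hX[f1 J1] /hX[f2 J2]; split; first exact: finite_energy_lin.
  have := mJ _ (finite_energy_lin 2^-1 2^-1 f1 f2).
  by move: J1 J2; rewrite /J !energy_lin2 // gdiff_lin; lra.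
(* Energy ignores constants, so only [X d x - X d (gone G)] can converge; it is the difference along
   [ginv x] at the identity. The pair [lc] holds limit and rate. *)
have rate x : exists lc : R * R, H x ->
    forall d, 0 < d -> `|X d x - X d (gone G) - lc.1| <= lc.2 * d.
  have [Hx|nHx] := pselect (H x); last by exists (0, 0).
  have [C C0 hC] := gdiff_bounded genS (HV _ Hx).
  have [|l hl] := @linear_rate_limit (fun d => X d x - X d (gone G)) (2 * C + 1); last first.
    by exists (l, 2 * C + 1).
  move=> d d' d0 d'0; have [fd le_d] := parallelogram _ _ d0 d'0.
  have [sd le_C] := hC _ fd.
  have := sq_le_dot (gone G) sd; rewrite {1}/gdiff /lact ginvK gmul1 => le_dot.
  (* [(2 C + 1)^2 >= 2 C] supplies a rate without taking a square root. *)
  have le_sq : (X d x - X d (gone G) - (X d' x - X d' (gone G))) ^+ 2 <=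
      ((2 * C + 1) * (d + d')) ^+ 2.
    apply: (le_trans (y := C * (2 * (d ^+ 2 + d' ^+ 2)))).
      apply: le_trans (le_trans le_C _); last by rewrite ler_pM2l.
      by apply: le_trans le_dot; rewrite le_eqVlt; apply/orP; left; apply/eqP; ring.
    have : 0 < d * d' by rewrite mulr_gt0.
    have := sqr_ge0 d; have := sqr_ge0 d'; nra.
  have cd0 : 0 <= (2 * C + 1) * (d + d') by apply: mulr_ge0; lra.
  by rewrite -ler_sqr ?nnegrE // real_normK ?num_real.
have [lc hlc] := choice rate.
pose k x := if `[< H x >] then (lc x).1 else 0.
have kE x : H x -> k x = (lc x).1 by move=> Hx; rewrite /k asboolT.
have k0 x : ~ H x -> k x = 0 by move=> Hx; rewrite /k asboolF.
have close g x : H g -> H x -> exists c : R, forall d, 0 < d ->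
    `|gdiff g k x - gdiff g (X d) x| <= c * d.
  move=> Hg Hx; have Hgx : H (ginv g *g x) by apply: HM => //; exact: HV.
  exists ((lc (ginv g *g x)).2 + (lc x).2) => d d0.
  have := hlc _ Hx _ d0; have := hlc _ Hgx _ d0.
  rewrite /gdiff /lact !kE // !ler_norml => /andP[? ?] /andP[? ?].
  by apply/andP; split; lra.
(* Edges lie inside [H] or have both ends outside it. Outside, [k] has zero difference and the
   one-sided bound holds with constant 0. *)
have /choice[C hC] : forall sx : G * G, exists c : R, sx.1 \in S -> forall d, 0 < d ->
    `|gdiff sx.1 k sx.2| <= `|gdiff sx.1 (X d) sx.2| + c * d.
  move=> [s x] /=; have [Hx|nHx] := pselect (H x).
    have [sS|] := boolP (s \in S); last by exists 0.
    have [c hc] := close s x (SH _ sS) Hx; exists c => _ d d0.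
    have := hc d d0; have := ler_normD (gdiff s (X d) x) (gdiff s k x - gdiff s (X d) x).
    by rewrite addrC subrK; lra.
  exists 0 => sS d d0; rewrite /gdiff /lact !k0 ?subrr ?normr0 ?mul0r ?addr0 //.
  by move=> Hx; apply: nHx; rewrite -(gmulVKl s x); apply: HM => //; exact: SH.
have [c hc] := close h (gone G) Hh H1.
have c0 : 0 <= c by have := hc 1 ltr01; rewrite mulr1; exact: le_trans.
pose phi := gdiff h k (gone G).
have [fk le_k] : finite_energy S k /\ energy S k k <= m + 2 * phi.
  apply: finite_energy_bounded => F uF.
  pose Q := \sum_(s <- S) \sum_(x <- F) C (s, x) ^+ 2.
  have Q0 : 0 <= Q by apply: sumr_ge0 => s _; apply: sumr_ge0 => x _; exact: sqr_ge0.
  apply: (@le_of_le_linear _ _ (`|m + 2 * phi| + 2 * (1 + 2 * c) + 2 * Q)) => d d0 d1.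
  (* Termwise [(|b| + t d)^2 <= (1 + d) b^2 + (d + d^2) t^2]. As [F] is finite, [Q] is a constant
     independent of [d]. *)
  apply: (le_trans (y := (1 + d) * energy S (X d) (X d) + (d + d ^+ 2) * Q)).
    have [fX _] := hX d d0.
    apply: (le_trans (y := (1 + d) * (\sum_(s <- S) \sum_(x <- F) gdiff s (X d) x ^+ 2)
        + (d + d ^+ 2) * Q)); last first.
      by rewrite lerD2r ler_pM2l; [exact: sum_sq_le_energy | lra].
    rewrite /Q !mulr_sumr -big_split /= big_seq [leRHS]big_seq; apply: ler_sum => s sS.
    rewrite !mulr_sumr -big_split /=; apply: ler_sum => x _.
    have := hC (s, x) sS d d0 => /=; set a := gdiff s k x; set b := gdiff s (X d) x.
    set t := C (s, x) => le_ab.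
    have a2 : a ^+ 2 <= (`|b| + t * d) ^+ 2.
      by rewrite -[a ^+ 2]real_normK ?num_real // ler_sqr ?nnegrE // (le_trans _ le_ab).
    have b2 : `|b| ^+ 2 = b ^+ 2 by rewrite real_normK ?num_real.
    apply: le_trans a2 _; rewrite -b2.
    have := mulr_ge0 (ltW d0) (sqr_ge0 (`|b| - t)); lra.
  have [_] := hX d d0; have := hc d d0; rewrite /J -/phi ler_norml => /andP[c1 c2] JX.
  have le1 : energy S (X d) (X d) <= (m + 2 * phi) + (d ^+ 2 + 2 * c * d) by lra.
  apply: (le_trans (y := (1 + d) * ((m + 2 * phi) + (d ^+ 2 + 2 * c * d)) + (d + d ^+ 2) * Q)).
    by rewrite lerD2r ler_pM2l //; lra.
  exact: quadratic_error_le.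
exists k; split=> // xi fx; by apply: le_trans (mJ _ fx); rewrite lerBlDr.
Qed.

(** First variation at the minimizer: [t^2 a + 2 t b >= 0] for all [t]. Taking [t = - b / (a + 1)],
    with a denominator that is never 0, forces [b = 0]. *)
Lemma exists_kernel S H h : generates H S -> H h ->
  exists k, [/\ supported H k, finite_energy S k & forall xi, finite_energy S xi ->
    energy S xi k = gdiff h xi (gone G)].
Proof.
move=> genS Hh; have [k [sk fk mink]] := energy_minimizer genS Hh.
exists k; split=> // xi fx.
set a := energy S xi xi; set b := energy S xi k - gdiff h xi (gone G).
have a0 : 0 <= a by exact: energy_ge0.
have var t : 0 <= t ^+ 2 * a + 2 * t * b.
  have := mink _ (finite_energy_lin 1 t fk fx).
  rewrite energy_lin2 // gdiff_lin [energy S k xi]energyC -/a -(subr_ge0 (energy S k k - _)).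
  by congr (0 <= _); rewrite /b; ring.
have := var (- b / (a + 1)).
have a1 : a + 1 != 0 by rewrite lt0r_neq0 // ltr_wpDl.
have -> : (- b / (a + 1)) ^+ 2 * a + 2 * (- b / (a + 1)) * b =
    - ((b / (a + 1)) ^+ 2 * (a + 2)) by field.
rewrite oppr_ge0 => le0; apply/eqP; rewrite -subr_eq0 -/b.
have a2 : 0 < a + 2 by lra.
have : (b / (a + 1)) ^+ 2 == 0 by rewrite eq_le sqr_ge0 andbT -(pmulr_lle0 _ a2).
by rewrite sqrf_eq0 mulf_eq0 invr_eq0 (negbTE a1) orbF.
Qed.

(** The form is only semidefinite, so [y = 0] is a separate case: if [a] were nonzero, the
    coefficients [1] and [- (x + 1) / (2 a)] would give the value -1. *)
Lemma energy_CauchySchwarz S xi zeta : finite_energy S xi -> finite_energy S zeta ->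
  energy S xi zeta ^+ 2 <= energy S xi xi * energy S zeta zeta.
Proof.
move=> fx fz; have x0 := energy_ge0 fx; have y0 := energy_ge0 fz.
have := fun s t => energy_ge0 (finite_energy_lin s t fx fz).
move: x0 y0; under [forall s t : R, _]eq_forall do under eq_forall do rewrite energy_lin2 //.
set x := energy S xi xi; set y := energy S zeta zeta; set a := energy S xi zeta.
move=> x0 y0 pos; have [y1|y1|y1] := ltgtP 0 y; last 2 first.
- by move: y0; rewrite leNgt y1.
- rewrite -y1 mulr0; have [->|a0] := eqVneq a 0; first by rewrite expr0n.
  have := pos 1 (- (x + 1) / (2 * a)); rewrite -y1 mulr0 addr0 expr1n mul1r.
  have -> : 2 * 1 * (- (x + 1) / (2 * a)) * a = - (x + 1) by field.
  lra.
- have := pos y (- a).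
  have -> : y ^+ 2 * x + 2 * y * - a * a + (- a) ^+ 2 * y = y * (x * y - a ^+ 2) by ring.
  by rewrite pmulr_rge0 // subr_ge0.
Qed.

(** * Translation, symmetry and trace of the kernels *)

Lemma gmulrK y : cancel (fun x => x *g y) (fun x => x *g ginv y).
Proof. by move=> x; exact: gmulKr. Qed.

Lemma gmulrVK y : cancel (fun x => x *g ginv y) (fun x => x *g y).
Proof. by move=> x; exact: gmulVKr. Qed.

Lemma finite_energy_rtrans S y xi : finite_energy S xi -> finite_energy S (fun x => xi (x *g y)).
Proof.
move=> fx s sS; rewrite (_ : gdiff _ _ = fun x => gdiff s xi (x *g y)).
  exact: (sqsummable_reindex (gmulrK y) (gmulrVK y) (fx s sS)).
by apply/funext => x; exact: gdiff_rtrans.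
Qed.

Lemma energy_rtrans S y xi zeta : finite_energy S xi -> finite_energy S zeta ->
  energy S (fun x => xi (x *g y)) (fun x => zeta (x *g y)) = energy S xi zeta.
Proof.
move=> fx fz; apply: eq_big_seq => s sS.
rewrite -(dot_reindex (gmulrK y) (gmulrVK y) (fx s sS) (fz s sS)).
by congr dot; apply/funext => x; exact: gdiff_rtrans.
Qed.

Definition reproducing S h (k : G -> R) := finite_energy S k /\
  forall xi, finite_energy S xi -> energy S xi k = gdiff h xi (gone G).

Lemma reproducing_rtrans S h k y xi : reproducing S h k -> finite_energy S xi ->
  energy S xi (fun x => k (x *g ginv y)) = gdiff h xi y.
Proof.
move=> [fk kE] fx; rewrite -(energy_rtrans y fx (finite_energy_rtrans (ginv y) fk)).
have -> : (fun x => k (x *g y *g ginv y)) = k by apply/funext => x; rewrite gmulKr.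
by rewrite (kE _ (finite_energy_rtrans y fx)) gdiff_rtrans gone_mul.
Qed.

(** Both sides are the energy of one kernel against a translate of the other, and energy is
    invariant under right translation. *)
Lemma reproducing_sym S g h k k' x : reproducing S g k -> reproducing S h k' ->
  gdiff h k x = gdiff g k' (ginv x).
Proof.
move=> rk rk'; have [fk _] := rk; have [fk' _] := rk'.
rewrite -(reproducing_rtrans x rk' fk) -(reproducing_rtrans (ginv x) rk fk').
rewrite energyC -(energy_rtrans x (finite_energy_rtrans (ginv x) fk') fk) ginvK.
have -> : (fun z => k' (z *g x *g ginv x)) = k' by apply/funext => z; rewrite gmulKr.
by [].
Qed.

Lemma finite_energy_generates S S' H xi : generates H S -> generates H S' ->
  finite_energy S xi -> finite_energy S' xi.
Proof.
by move=> gS [_ [S'H _]] fx s /S'H Hs; have [C _ /(_ _ fx)[]] := gdiff_bounded gS Hs.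
Qed.

(* Both sides are the same sum over edge pairs, because the kernel matrix of
   either generating set is symmetric up to the inversion [x -> x^-1]. *)
Lemma kernel_trace_generates S S' H (k k' : G -> G -> R) :
  generates H S -> generates H S' ->
  (forall h, H h -> reproducing S h (k h)) -> (forall h, H h -> reproducing S' h (k' h)) ->
  \sum_(s <- S) gdiff s (k s) (gone G) = \sum_(s <- S') gdiff s (k' s) (gone G).
Proof.
move=> gS gS' rk rk'; have [_ [SH _]] := gS; have [_ [S'H _]] := gS'.
(* Each [s] in [S] lies in [H], so [k' s] represents the difference along [s] for the energy of
   [S']; apply this to [k s]. *)
transitivity (\sum_(s <- S) \sum_(t <- S') dot (gdiff t (k s)) (gdiff t (k' s))).
  apply: eq_big_seq => s /SH Hs; have [_ <-] := rk' _ Hs => //.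
  by apply: finite_energy_generates gS gS' _; case: (rk _ Hs).
transitivity (\sum_(t <- S') \sum_(s <- S) dot (gdiff s (k' t)) (gdiff s (k t))); last first.
  apply: eq_big_seq => t /S'H Ht; have [_ <-] := rk _ Ht => //.
  by apply: finite_energy_generates gS' gS _; case: (rk' _ Ht).
rewrite exchange_big /=; apply: eq_big_seq => t tS'; apply: eq_big_seq => s sS.
have [Hs Ht] := (SH _ sS, S'H _ tS').
have [[fk _] [fk' _]] := (rk _ Ht, rk' _ Ht).
have invK : cancel (@ginv G) (@ginv G) := ginvK.
have fk2 : finite_energy S (k' t) by exact: finite_energy_generates gS' gS fk'.
rewrite dotC -[RHS](dot_reindex invK invK (fk2 s sS) (fk s sS)).
congr dot; apply/funext => x.
- exact: reproducing_sym (rk' _ Hs) (rk' _ Ht).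
- exact: reproducing_sym (rk _ Hs) (rk _ Ht).
Qed.

(** * Cocycles as gradients, and their von Neumann dimension *)

Lemma cocycle_potential S H (v : 'I_(size S) -> G -> R) : generates H S ->
  @cocycle_vec G H S v -> (forall i, supported H (v i)) ->
  exists xi, forall i x, v i x = gdiff (nth (gone G) S i) xi x.
Proof.
move=> [[H1 HM HV] [SH _]] [c [cM cv]] sv.
(* The cocycle identity for [x] as the product of [s] and [ginv s *g x], evaluated at [x], writes
   [c s x] as the difference of the diagonal values [c x x] at [x] and at [ginv s *g x]. *)
exists (fun x => if `[< H x >] then - c x x else 0) => i x.
have Hs : H (nth (gone G) S i) by apply: SH; rewrite mem_nth.
set s := nth _ _ _ in Hs *; rewrite /gdiff /lact.
have [Hx|nHx] := pselect (H x).
  have Hsx : H (ginv s *g x) by apply: HM => //; exact: HV.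
  rewrite !asboolT // -cv -/s.
  have := cM _ _ Hs Hsx x; rewrite gmulVKl /lact => ->; ring.
rewrite !asboolF ?subrr; [exact: sv | exact: nHx | move=> Hsx; apply: nHx].
by rewrite -(gmulVKl s x); exact: HM.
Qed.

(** Unit-ball cocycles are gradients of energy at most 1. Cauchy-Schwarz against [k] bounds their
    value by [sqrt q], attained by the gradient of [k / sqrt q]. *)
Lemma sup_cocycle_sq S H (i : 'I_(size S)) k : generates H S -> supported H k ->
  reproducing S (nth (gone G) S i) k ->
  sup [set v i (gone G) | v in [set v | @cocycle_vec G H S v /\
    (forall j, supported H (v j)) /\ vnorm_le1 v]] ^+ 2 = gdiff (nth (gone G) S i) k (gone G).
Proof.
move=> gS sk [fk kE]; have [[H1 HM HV] [SH _]] := gS.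
set A := (X in sup X); set s := nth _ _ _ in kE *.
set q := gdiff s k (gone G).
have qE : energy S k k = q by rewrite kE.
have q0 : 0 <= q by rewrite -qE energy_ge0.
have sumS (f : G -> R) : \sum_(j < size S) f (nth (gone G) S j) = \sum_(s <- S) f s.
  by rewrite [RHS](big_nth (gone G)) big_mkord.
suff -> : sup A = Num.sqrt q by rewrite sqr_sqrtr.
apply/eqP; rewrite eq_le; apply/andP; split.
  apply: ge_sup.
    exists 0; exists (fun _ _ => 0) => //=; split; [|split].
    - exists (fun _ _ => 0); split=> // g h _ _ x; by rewrite /lact addr0.
    - by [].
    - by move=> F uF; rewrite big1 // => j _; rewrite big1 // => x _; rewrite expr0n.
  move=> _ [v /= [cv [sv nv]] <-].
  have [xi xiE] := cocycle_potential gS cv sv.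
  have [fxi le1] : finite_energy S xi /\ energy S xi xi <= 1.
    apply: finite_energy_bounded => F uF.
    rewrite -(sumS (fun s => \sum_(x <- F) gdiff s xi x ^+ 2)).
    apply: le_trans (nv F uF); rewrite le_eqVlt; apply/orP; left; apply/eqP.
    by apply: eq_bigr => j _; apply: eq_bigr => x _; rewrite xiE.
  apply: le_trans (ler_norm _) _; rewrite -sqrtr_sqr ler_wsqrtr // xiE -kE //.
  apply: le_trans (energy_CauchySchwarz fxi fk) _.
  by rewrite qE ler_piMl.
(* For [q = 0] this gives [c = 0], so [xi] is zero and still attains the supremum. *)
pose c := (Num.sqrt q)^-1; pose xi := fun x => c * k x + 0 * k x.
have fxi : finite_energy S xi by exact: finite_energy_lin.
have xiE x g : gdiff g xi x = c * gdiff g k x by rewrite /xi gdiff_lin mul0r addr0.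
have eE : energy S xi xi <= 1.
  rewrite /xi energy_lin2 // mulr0 expr0n !mul0r !addr0 qE.
  have [->|qn0] := eqVneq q 0; first by rewrite mulr0 ler01.
  by rewrite /c exprVn sqr_sqrtr // mulVf.
apply: ub_le_sup.
  exists (Num.sqrt 1) => _ [v /= [cv [sv nv]] <-].
  apply: le_trans (ler_norm _) _; rewrite -sqrtr_sqr ler_wsqrtr //.
  have := nv [:: gone G] isT; under eq_bigr do rewrite big_seq1.
  apply: le_trans; rewrite (bigD1 i) //= lerDl sumr_ge0 // => j _; exact: sqr_ge0.
exists (fun j => gdiff (nth (gone G) S j) xi) => /=; last first.
  rewrite -/s xiE -/q /c; have [->|qn0] := eqVneq q 0; first by rewrite sqrtr0 mulr0.
  rewrite -{2}[q]sqr_sqrtr // expr2 mulrA mulVf ?mul1r //.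
  by rewrite sqrtr_eq0 -ltNge lt0r qn0.
split; [|split].
- exists (fun g => gdiff g xi); split=> // g h _ _ x.
  by rewrite gdiffM addrC.
- move=> j x nHx; have Hsj : H (nth (gone G) S j) by apply: SH; rewrite mem_nth.
  rewrite xiE /gdiff /lact !sk ?subrr ?mulr0 // => Hsx; apply: nHx.
  by rewrite -(gmulVKl (nth (gone G) S j) x); exact: HM.
- move=> F uF; apply: le_trans eE.
  by rewrite (sumS (fun s => \sum_(x <- F) gdiff s xi x ^+ 2)); exact: sum_sq_le_energy.
Qed.

Lemma vN_dim_cocycle S H (k : G -> G -> R) : generates H S ->
  (forall h, H h -> supported H (k h)) -> (forall h, H h -> reproducing S h (k h)) ->
  vN_dim H (@cocycle_vec G H S) = \sum_(s <- S) gdiff s (k s) (gone G).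
Proof.
move=> gS sk rk; rewrite [RHS](big_nth (gone G)) big_mkord; apply: eq_bigr => i _.
have Hs : H (nth (gone G) S i) by case: gS => _ [SH _]; apply: SH; rewrite mem_nth.
by apply: sup_cocycle_sq => //; [exact: sk | exact: rk].
Qed.

(** * Trace bound for the edges inside a finite set *)

Lemma finite_energy_sum S (I : eqType) (r : seq I) (c : I -> R) (k : I -> G -> R) :
  (forall i, i \in r -> finite_energy S (k i)) ->
  finite_energy S (fun x => \sum_(i <- r) c i * k i x).
Proof.
elim: r => [|i r ih] fk.
  by under eq_fun do rewrite big_nil; exact: finite_energy0.
under eq_fun do rewrite big_cons -[X in _ + X]mul1r.
apply: finite_energy_lin; first by apply: fk; rewrite mem_head.
by apply: ih => j jr; apply: fk; rewrite inE jr orbT.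
Qed.

Lemma energy_sumr S (I : eqType) (r : seq I) (c : I -> R) (k : I -> G -> R) xi :
  finite_energy S xi -> (forall i, i \in r -> finite_energy S (k i)) ->
  energy S xi (fun x => \sum_(i <- r) c i * k i x) = \sum_(i <- r) c i * energy S xi (k i).
Proof.
move=> fx; elim: r => [|i r ih] fk.
  under eq_fun do rewrite big_nil.
  rewrite big_nil /energy big1 // => s _; rewrite -[RHS](tsumE (@has_sum0 _ G)).
  by congr tsum; apply/funext => x; rewrite /gdiff /lact subrr mulr0.
under eq_fun do rewrite big_cons -[X in _ + X]mul1r.
have fi : finite_energy S (k i) by apply: fk; rewrite mem_head.
have fr j : j \in r -> finite_energy S (k j) by move=> jr; apply: fk; rewrite inE jr orbT.
rewrite energyC energy_linl //; last exact: finite_energy_sum.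
by rewrite big_cons mul1r energyC [X in _ + X]energyC ih.
Qed.

Lemma gdiff_sum (I : Type) (r : seq I) (c : I -> R) (k : I -> G -> R) g x :
  gdiff g (fun x => \sum_(i <- r) c i * k i x) x = \sum_(i <- r) c i * gdiff g (k i) x.
Proof. by rewrite /gdiff /lact -sumrB; apply: eq_bigr => i _; rewrite mulrBr. Qed.

(* The kernel matrix of the edges inside [F] is a contraction whose columns are
   gradients of functions on [F], so its trace is at most its rank, hence at most [|F|]. *)
Lemma kernel_edge_sum_le S (k : G -> G -> R) (F : seq G) :
  (forall s, s \in S -> reproducing S s (k s)) -> uniq F ->
  \sum_(s <- S) gdiff s (k s) (gone G) * (count (fun g => g *g s \in F) F)%:R <= (size F)%:R.
Proof.
move=> rk uF.
pose E := [seq a <- [seq (s, g) | s <- S, g <- F] | a.2 *g a.1 \in F].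
have ES a : a \in E -> a.1 \in S.
  by rewrite mem_filter => /andP[_ /allpairsP[[s g] [sS _ ->]]].
pose ka (a : G * G) x := k a.1 (x *g a.2).
pose D xi (b : G * G) := gdiff b.1 xi (ginv b.2).
have fka a : a \in E -> finite_energy S (ka a).
  by move=> /ES aS; apply: finite_energy_rtrans; case: (rk _ aS).
have eka a xi : a \in E -> finite_energy S xi -> energy S xi (ka a) = D xi a.
  move=> /ES aS fx; rewrite /D -(reproducing_rtrans (ginv a.2) (rk _ aS) fx).
  by rewrite ginvK.
(* The gradient on [E] of the indicator of the vertex [y]. The potential at [y] is [xi (ginv y)], so
   gradients on [E] are combinations of these [|F|] vectors. *)
pose w y (b : G * G) : R := (b.2 *g b.1 == y)%:R - (b.2 == y)%:R.
have pick f z : z \in F -> \sum_(y <- F) f y * (z == y)%:R = f z :> R.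
  move=> zF; rewrite (bigD1_seq z) //= eqxx mulr1 big1 ?addr0 // => y yz.
  by rewrite eq_sym (negbTE yz) mulr0.
have Dw xi b : b \in E -> D xi b = \sum_(y <- F) xi (ginv y) * w y b.
  rewrite mem_filter => /andP[bF /allpairsP[[s g] [_ gF bE]]].
  rewrite /w; under eq_bigr do rewrite mulrBr; rewrite sumrB.
  rewrite (pick (fun y => xi (ginv y))) // (pick (fun y => xi (ginv y))) ?bE //.
  by rewrite /D /gdiff /lact ginvM.
have [ o [ o1 _ ow]] := Gram_Schmidt E F w.
set d := size F in ow *.
have DE xi : expands E d o (D xi).
  move=> b bE; rewrite Dw // (expands_lin _ ow) //.
  by apply: eq_bigr => j _; congr (_ * _); apply: eq_fdotl => a aE; rewrite Dw.
have -> : \sum_(s <- S) gdiff s (k s) (gone G) * (count (fun g => g *g s \in F) F)%:R =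
    \sum_(a <- E) D (ka a) a.
  rewrite /E big_filter [RHS]big_mkcond big_allpairs_dep; apply: eq_bigr => s _.
  rewrite -big_mkcond -sum1_count natr_sum mulr_sumr; apply: eq_bigr => g _.
  by rewrite mulr1 /D /ka /= gdiff_rtrans gVmul.
rewrite (eq_big_seq _ (fun a aE => DE (ka a) a aE)) exchange_big /=.
(* The trace has become [sum_j <K o_j, o_j>], with [K] the kernel matrix on [E]; each term is at
   most 1. *)
apply: (le_trans (y := \sum_(0 <= j < d) 1)); last by rewrite sumr_const_nat subn0.
apply: ler_sum => j _.
pose u x := \sum_(a <- E) o j a * ka a x.
have fu : finite_energy S u by apply: finite_energy_sum.
have -> : \sum_(a <- E) fdot E (D (ka a)) (o j) * o j a = \sum_(b <- E) o j b * D u b.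
  transitivity (\sum_(b <- E) \sum_(a <- E) D (ka a) b * o j b * o j a).
    by rewrite exchange_big; apply: eq_bigr => a _; rewrite /fdot mulr_suml.
  apply: eq_bigr => b _; rewrite /D gdiff_sum mulr_sumr.
  by apply: eq_bigr => a _; rewrite /D; ring.
have Uu : energy S u u = \sum_(b <- E) o j b * D u b.
  by rewrite {2}/u energy_sumr //; apply: eq_big_seq => a aE; rewrite eka.
have le_u : \sum_(b <- E) D u b ^+ 2 <= energy S u u.
  have uF' : uniq (map (@ginv G) F) by rewrite map_inj_uniq //; exact: can_inj (ginvK).
  apply: le_trans (sum_sq_le_energy fu uF').
  rewrite /E big_filter [leLHS]big_mkcond big_allpairs_dep; apply: ler_sum => s _.
  rewrite big_map; apply: ler_sum => g _; case: ifP => // _; exact: sqr_ge0.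
have le_o := o1 j.
(* With [Q] the energy of [u]: [Q = <o_j, D u> <= (|o_j|^2 + |D u|^2) / 2 <= (1 + Q) / 2], hence
   [Q <= 1]. *)
have : \sum_(b <- E) o j b * D u b <= 2^-1 * (fdot E (o j) (o j) + \sum_(b <- E) D u b ^+ 2).
  rewrite /fdot -big_split mulr_sumr; apply: ler_sum => b _.
  by have := sqr_ge0 (o j b - D u b) => /=; lra.
by move: Uu le_u le_o; lra.
Qed.

(** * Cheeger constants *)

Definition inner_edges S (F : seq G) : nat := \sum_(g <- F) count (fun s => g *g s \in F) S.

Lemma boundary_inner S F : (boundary S F + inner_edges S F = size F * size S)%N.
Proof.
rewrite /boundary /inner_edges -big_split /= (eq_bigr (fun=> size S)).
  by rewrite big_const_seq count_predT iter_addn_0 mulnC.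
by move=> g _; rewrite addnC (count_predC (fun s => g *g s \in F)).
Qed.

Lemma cheeger_ge0 S : 0 <= cheeger S.
Proof.
apply: lb_le_inf; last by move=> _ [F _ <-]; rewrite divr_ge0.
by exists ((boundary S [:: gone G])%:R / (size [:: gone G])%:R); exists [:: gone G].
Qed.

Lemma econst_le1 S : econst S <= 1.
Proof. by rewrite /econst lerBlDr lerDl divr_ge0 // cheeger_ge0. Qed.

(** By [boundary_inner], [econst S * |S| = |S| - cheeger S] is the supremum of the average inner
    degree over finite sets. *)
Lemma econst_le S (M : R) : S != [::] ->
  (forall F, uniq F -> (inner_edges S F)%:R <= M * (size F)%:R) ->
  econst S * (size S)%:R <= M.
Proof.
move=> S0 hM; have n0 : (size S)%:R != 0 :> R by rewrite pnatr_eq0 size_eq0.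
rewrite /econst mulrBl mul1r divfK // lerBlDr addrC -lerBlDr.
apply: lb_le_inf.
  by exists ((boundary S [:: gone G])%:R / (size [:: gone G])%:R); exists [:: gone G].
move=> _ [F [uF F0] <-].
have f0 : 0 < (size F)%:R :> R by rewrite ltr0n lt0n size_eq0.
rewrite ler_pdivlMr // mulrBl lerBlDr.
have := congr1 (fun n => n%:R : R) (boundary_inner S F); rewrite natrD natrM mulrC => <-.
by rewrite lerD2l; exact: hM.
Qed.

(** For [s] in [S] other than the identity, the set of the identity and [s] has an inner edge.
    Positivity allows exponentiating [ln (econst S)] later. *)
Lemma econst_gt0 S : uniq S -> (1 < size S)%N -> 0 < econst S.
Proof.
move=> uS S1; have n0 : 0 < (size S)%:R :> R by rewrite ltr0n (ltn_trans _ S1).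
have [s sS s1] : exists2 s, s \in S & s != gone G.
  apply/hasP; apply: contraT; rewrite -all_predC => /allP h.
  have : (size S <= size [:: gone G])%N.
    by apply: uniq_leq_size => // s /h /=; rewrite negbK inE.
  by rewrite leqNgt S1.
pose F := [:: gone G; s].
have uF : uniq F by rewrite /= inE eq_sym s1.
have lt_b : (boundary S F < 2 * size S)%N.
  rewrite -(boundary_inner S F) -[ltnLHS]addn0 ltn_add2l /inner_edges big_cons.
  rewrite addn_gt0 -has_count; apply/orP; left; apply/hasP; exists s => //.
  by rewrite gone_mul !inE eqxx orbT.
rewrite /econst subr_gt0 ltr_pdivrMr // mul1r.
apply: (@le_lt_trans _ _ ((boundary S F)%:R / (size F)%:R)).
  apply: ge_inf; last by exists F.
  by exists 0 => _ [F' _ <-]; rewrite divr_ge0.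
by rewrite ltr_pdivrMr // -natrM ltr_nat mulnC.
Qed.

Lemma eta_quot_le0 S : eta_quot S <= 0.
Proof.
rewrite /eta_quot mulr_le0_ge0 ?ln_le0 ?econst_le1 // invr_ge0.
have [->|n0] := posnP (size S); first by rewrite ln0.
by rewrite ln_ge0 // ler1n.
Qed.

Lemma econst_ge S (eps : R) : uniq S -> (1 < size S)%N -> - eps <= eta_quot S ->
  (size S)%:R `^ (1 - eps) <= econst S * (size S)%:R.
Proof.
move=> uS S1; have e0 := econst_gt0 uS S1.
have n1 : 1 < (size S)%:R :> R by rewrite ltr1n.
have n0 : 0 < (size S)%:R :> R by exact: lt_trans n1.
rewrite /eta_quot ler_pdivlMr ?ln_gt0 // => h.
rewrite powRD; last by rewrite (gt_eqF n0) implybT.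
rewrite powRr1 ?(ltW n0) // mulrC ler_pM2r //.
by rewrite -ler_ln ?posrE ?powR_gt0 // ln_powR.
Qed.

(** A supremum of infima above [- eps] has one witness [S0]. Evaluating at [S0] itself, where the
    quotient is nonpositive, gives [eps > 0]. *)
Lemma eta_grp_lt (eps : R) : (eta_grp G < eps%:E)%E -> ~ group_finite G ->
  0 < eps /\ exists2 S0, Defs.symmetric S0 & forall S, Defs.symmetric S -> {subset S0 <= S} ->
    - eps <= eta_quot S.
Proof.
rewrite /eta_grp => lt_eta nfin; move: lt_eta; rewrite asboolF //.
rewrite -[eps%:E]oppeK lteN2 /liminf_sym => /ereal_sup_gt[_ [S0 sS0 <-] lt_inf].
have h S : Defs.symmetric S -> {subset S0 <= S} -> (- eps%:E < (eta_quot S)%:E)%E.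
  move=> sS sub; apply: lt_le_trans lt_inf _; apply: ereal_inf_lbound.
  by exists S.
split.
  have := h S0 sS0 (fun _ => id); rewrite -EFinN lte_fin => lt0.
  by have := eta_quot_le0 S0; lra.
exists S0 => // S sS sub; have := h S sS sub.
by rewrite -EFinN lte_fin => /ltW.
Qed.

(** * Level sets of the kernel diagonal *)

Lemma kernel_diag_bounds S s k : s \in S -> reproducing S s k ->
  0 <= gdiff s k (gone G) <= 1.
Proof.
move=> sS [fk kE]; have := energy_ge0 fk; have := sq_le_dot (gone G) (fk s sS).
have := dot_le_energy fk sS; rewrite kE //; set q := gdiff s k _ => le1 le2 q0.
(* The square [q^2] is one term of the energy of [k], which equals [q]. *)
have : q * (q - 1) <= 0 by lra.
by rewrite q0 /=; case: (ltP 1 q) => // q1; rewrite leNgt mulr_gt0 //; lra.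
Qed.

Lemma inner_edges_swap S F :
  inner_edges S F = (\sum_(s <- S) count (fun g => g *g s \in F) F)%N.
Proof.
rewrite /inner_edges; under eq_bigr do rewrite -sum1_count big_mkcond.
by rewrite exchange_big; apply: eq_bigr => s _; rewrite /= -big_mkcond sum1_count.
Qed.

Lemma count_rtransV s F : uniq F ->
  (count (fun g => g *g ginv s \in F) F <= count (fun g => g *g s \in F) F)%N.
Proof.
move=> uF; rewrite -!size_filter -(size_map (fun g => g *g ginv s)).
apply: uniq_leq_size.
  by rewrite map_inj_uniq ?filter_uniq //; exact: can_inj (gmulrVK s).
move=> x /mapP[g]; rewrite mem_filter => /andP[gsF gF] ->.
by rewrite mem_filter gmulVKr gF.
Qed.

(** An element of [S0] contributes at most [|F|] inner edges; reversing edges shows that [ginv s]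
    contributes no more than [s]. *)
Lemma inner_edges_symmetrize S0 S F : uniq F ->
  (inner_edges (undup (S0 ++ S ++ map (@ginv G) S)) F
   <= size S0 * size F + 2 * inner_edges S F)%N.
Proof.
move=> uF; apply: (@leq_trans (inner_edges (S0 ++ S ++ map (@ginv G) S) F)).
  by apply: leq_sum => g _; rewrite leq_count_subseq // undup_subseq.
rewrite inner_edges_swap !big_cat /= big_map leq_add //.
  apply: (@leq_trans (\sum_(s <- S0) size F)); first by apply: leq_sum => s _; exact: count_size.
  by rewrite big_const_seq count_predT iter_addn_0 mulnC.
rewrite mul2n -addnn inner_edges_swap leq_add2l; apply: leq_sum => s _.
exact: count_rtransV.
Qed.

(** The trace bound gives [T] at most [|F| / c] inner edges, so [S'] has average inner degree at
    most [|S0| + 2 / c]. Since [S'] contains [S0], that degree bound is at least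
    [|S'|^(1 - eps)]. *)
Lemma level_set_bound (eps c : R) S0 S (k : G -> G -> R) :
  Defs.symmetric S0 -> uniq S -> eps <= 1 -> 0 < c -> c <= 1 ->
  (forall s, s \in S -> reproducing S s (k s)) ->
  (forall S', Defs.symmetric S' -> {subset S0 <= S'} -> - eps <= eta_quot S') ->
  c * (count (fun s => c <= gdiff s (k s) (gone G)) S)%:R `^ (1 - eps) <= (size S0)%:R + 2.
Proof.
move=> sym0 uS e1 c0 c1 rk hS0.
pose q s := gdiff s (k s) (gone G).
pose T := [seq s <- S | c <= q s].
rewrite -size_filter -/T.
pose S' := undup (S0 ++ T ++ map (@ginv G) T).
have uT : uniq T by rewrite filter_uniq.
have subT : (size T <= size S')%N.
  by apply: uniq_leq_size => // s sT; rewrite mem_undup !mem_cat sT orbT.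
have sym' : Defs.symmetric S'.
  split; first exact: undup_uniq.
  case: sym0 => _ sym0 s; rewrite !mem_undup !mem_cat => /or3P[/sym0 ->//|sT|/mapP[t tT ->]].
    by rewrite map_f ?orbT.
  by rewrite ginvK tT orbT.
have sub0 : {subset S0 <= S'} by move=> s s0; rewrite mem_undup mem_cat s0.
(* Here [eta_quot] would divide by [ln 1] or [ln 0], both 0. But [T] then has at most one element,
   and its power is at most 1 even under the convention that 0 to the power 0 is 1. *)
have [small|big] := leqP (size S') 1.
  have : (size T <= 1)%N by exact: leq_trans subT small.
  have p1 : (size T)%:R `^ (1 - eps) <= 1 -> c * (size T)%:R `^ (1 - eps) <= (size S0)%:R + 2.
    move=> p1; apply: (le_trans (ler_piMr (ltW c0) p1)).
    by have := ler0n R (size S0); lra.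
  case: (size T) p1 => [|[|//]] p1 _; apply: p1; last by rewrite powR1.
  rewrite /powR eqxx; case: eqP => //; by rewrite ler01.
have inner F : uniq F -> (inner_edges S' F)%:R <= ((size S0)%:R + 2 / c) * (size F)%:R.
  move=> uF; have := inner_edges_symmetrize S0 T uF.
  rewrite -(ler_nat R) natrD (natrM _ 2) (natrM _ (size S0)) => le1.
  suff le2 : (inner_edges T F)%:R <= c^-1 * (size F)%:R by lra.
  rewrite mulrC ler_pdivlMr // mulrC inner_edges_swap natr_sum mulr_sumr.
  apply: le_trans (kernel_edge_sum_le rk uF).
  rewrite big_filter big_mkcond big_seq [leRHS]big_seq; apply: ler_sum => s sS.
  case: ifP => [cq|_]; first by rewrite ler_wpM2r.
  by rewrite mulr_ge0 //; case/andP: (kernel_diag_bounds sS (rk s sS)).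
have S'0 : S' != [::] by rewrite -size_eq0 -lt0n (ltn_trans _ big).
have le1 := econst_ge (proj1 sym') big (hS0 _ sym' sub0).
have le2 := econst_le S'0 inner.
have le3 : (size T)%:R `^ (1 - eps) <= (size S')%:R `^ (1 - eps).
  by apply: ge0_ler_powR; rewrite ?nnegrE ?ler0n ?subr_ge0 // ler_nat.
have := ler_wpM2l (ltW c0) (le_trans le3 (le_trans le1 le2)).
have -> : c * ((size S0)%:R + 2 / c) = c * (size S0)%:R + 2 by field; rewrite gt_eqF.
by move/le_trans; apply; rewrite lerD2r ler_piMl.
Qed.

(** * Minimal generating sets and the first Betti number *)

Lemma rk_attained H : fin_gen H -> exists S, [/\ generates H S, uniq S & (size S)%:R = rk H].
Proof.
move=> [S0 gS0].
have ex : exists n, `[< exists2 S, generates H S & size S = n >].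
  by exists (size S0); apply/asboolP; exists S0.
case: (ex_minnP ex) => n /asboolP[S gS sS] minn.
(* Removing repetitions keeps the generated subgroup, and by minimality it also keeps the size. *)
have gU : generates H (undup S).
  case: gS => subH [SH minH]; split=> //.
  split=> [s|K sK SK]; first by rewrite mem_undup; exact: SH.
  by apply: minH => // s sS'; apply: SK; rewrite mem_undup.
have sU : size (undup S) = n.
  apply/eqP; rewrite eqn_leq -{1}sS size_undup; apply: minn; apply/asboolP.
  by exists (undup S).
exists (undup S); split=> //; first exact: undup_uniq.
rewrite sU; apply/eqP; rewrite eq_le; apply/andP; split.
  apply: lb_le_inf; first by exists (size S)%:R; exists S.
  move=> _ [S' /= gS' <-]; rewrite ler_nat; apply: minn; apply/asboolP.
  by exists S'.
apply: ge_inf; first by exists 0 => _ [S' _ <-].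
by exists (undup S); rewrite ?sU.
Qed.

(** [beta1] is computed from a chosen list [S']; trace invariance moves the cocycle dimension to
    [S], and the coboundary dimension, a sum of squares, is dropped. *)
Lemma beta1_le_kernel_trace H S : generates H S ->
  exists k, (forall s, s \in S -> reproducing S s (k s)) /\
    beta1 H <= \sum_(s <- S) gdiff s (k s) (gone G).
Proof.
move=> gS; have [_ [SH _]] := gS.
have kernels S' : generates H S' -> exists k : G -> G -> R, forall h, H h ->
    supported H (k h) /\ reproducing S' h (k h).
  move=> gS'; have /choice[k hk] : forall h, exists k : G -> R, H h ->
      supported H k /\ reproducing S' h k.
    move=> h; have [Hh|nHh] := pselect (H h); last by exists (fun=> 0).
    by have [k [sk fk kE]] := exists_kernel gS' Hh; exists k.
  by exists k.
have [k hk] := kernels S gS.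
exists k; split=> [s /SH Hs|]; first by case: (hk s Hs).
rewrite /beta1; set S' := ClassicalEpsilon.epsilon _ _.
have gS' : generates H S' by apply: ClassicalEpsilon.epsilon_spec; exists S.
have [k' hk'] := kernels S' gS'.
rewrite (kernel_trace_generates gS gS' (fun h Hh => proj2 (hk h Hh))
  (fun h Hh => proj2 (hk' h Hh))).
rewrite -(vN_dim_cocycle gS' (fun h Hh => proj1 (hk' h Hh)) (fun h Hh => proj2 (hk' h Hh))).
rewrite /beta1_with lerBlDr lerDl; apply: sumr_ge0 => i _; exact: sqr_ge0.
Qed.

End CayleyEnergy.

(** * Uniform bound over the finitely generated subgroups *)

Lemma ler_pdiv_of_le_mul (x y C : R) : 0 <= y -> 0 <= C -> x <= C * y -> x / y <= C.
Proof.
(* A trivial subgroup has rank 0; for [eps > 0] the power is then 0, and so is the quotient. *)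
rewrite le_eqVlt => /predU1P[<-|y0] C0 h; first by rewrite invr0 mulr0.
by rewrite ler_pdivrMr.
Qed.

Theorem theorem6p2 (Gamma : AbsGroup) (eps : R) :
  (eta_grp Gamma < eps%:E)%E ->
  exists C : R, forall Lambda : Gamma -> Prop,
    is_subgroup Lambda -> fin_gen Lambda ->
    beta1 Lambda / (rk Lambda `^ eps) <= C.
Proof.
move=> lt_eta.
have main Lambda : fin_gen Lambda -> exists S (k : Gamma -> Gamma -> R),
    [/\ generates Lambda S, uniq S, (size S)%:R = rk Lambda,
        forall s, s \in S -> reproducing S s (k s) &
        beta1 Lambda <= \sum_(s <- S) gdiff s (k s) (gone Gamma)].
  move=> /rk_attained[S [gS uS rS]]; have [k [rk bk]] := beta1_le_kernel_trace gS.
  by exists S, k.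
have trivial_bound S (k : Gamma -> Gamma -> R) :
    (forall s, s \in S -> reproducing S s (k s)) ->
    \sum_(s <- S) gdiff s (k s) (gone Gamma) <= (size S)%:R.
  move=> rk; rewrite -[size S]sum1_size natr_sum [leLHS]big_seq [leRHS]big_seq.
  by apply: ler_sum => s sS; case/andP: (kernel_diag_bounds sS (rk s sS)).
have [[l hl]|infinite] := pselect (group_finite Gamma).
  (* In a finite group [eps] may be any real, but ranks are at most [size l]; the sum dominates
     [r / r^eps] for each of them. *)
  exists (\sum_(0 <= n < (size l).+1) n%:R / n%:R `^ eps) => Lambda subL /main.
  move=> [S [k [gS uS rS rk bk]]]; rewrite -rS.
  have leS : (size S <= size l)%N by apply: uniq_leq_size => // s _; exact: hl.
  apply: (le_trans (y := (size S)%:R / (size S)%:R `^ eps)).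
    rewrite ler_wpM2r ?invr_ge0 ?powR_ge0 //; exact: le_trans bk (trivial_bound S k rk).
  by rewrite (bigD1_seq (size S)) ?iota_uniq ?mem_index_iota ?ltnS //= lerDl sumr_ge0.
have [e0 [S0 sym0 hS0]] := eta_grp_lt lt_eta infinite.
(* The first term serves [eps <= 1], with [A = |S0| + 2]; the added 1 serves [eps > 1], where the
   trace is at most [r <= r^eps]. *)
pose C : R := 2 * ((size S0)%:R + 2) / eps + 1.
have A0 : 0 <= (size S0)%:R + 2 :> R by rewrite addr_ge0.
have C0 : 0 <= 2 * ((size S0)%:R + 2) / eps by rewrite !mulr_ge0 // invr_ge0 ltW.
exists C => Lambda subL /main [S [k [gS uS rS rk bk]]]; rewrite -rS.
apply: ler_pdiv_of_le_mul; [exact: powR_ge0 | by rewrite addr_ge0 |].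
apply: le_trans bk _.
have [e1|e1] := leP eps 1.
  pose q := [seq gdiff s (k s) (gone Gamma) | s <- S].
  rewrite -(big_map (fun s => gdiff s (k s) (gone Gamma)) predT id) -/q.
  have sq : size q = size S by rewrite size_map.
  have qb x : x \in q -> 0 <= x <= 1.
    by move=> /mapP[s sS ->]; exact: kernel_diag_bounds sS (rk s sS).
  rewrite mulrDl mul1r -[leLHS]addr0 lerD ?powR_ge0 // -sq.
  apply: sum_le_of_level_bound => // x xq; first by case/andP: (qb x xq).
  (* The level bound requires a positive level, so [x = 0] is treated apart. *)
  case/andP: (qb x xq); rewrite le_eqVlt => /predU1P[<-|x0] x1; first by rewrite mul0r.
  by rewrite count_map; exact: level_set_bound.
apply: le_trans (trivial_bound S k rk) _.
have [->|n0] := posnP (size S); first by rewrite mulr_ge0 ?powR_ge0 // addr_ge0.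
have n1 : 1 <= (size S)%:R :> R by rewrite ler1n.
apply: (le_trans (y := 1 * (size S)%:R `^ eps)); last first.
  by rewrite ler_wpM2r ?powR_ge0 // /C lerDr.
rewrite mul1r -[leLHS]powRr1 ?ler0n //; exact: ler_powR (ltW e1).
Qed.
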